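(* Let $0<\alpha\le 1$ and let $f\in C^{1,\alpha}(\mathbb{R})$ be non-negative. Then $\sqrt f\in C^{\frac{1+\alpha}{2}}(\mathbb{R})$.
   Context: For $0<\alpha\le1$, $C^{1,\alpha}(\mathbb{R})$ is the set of continuously differentiable real-valued functions $f$ on $\mathbb{R}$ with $[f']_\alpha=\sup_{x\ne y}\frac{|f'(x)-f'(y)|}{|x-y|^\alpha}<\infty$. For $0<\gamma\le 1$, here $C^{\gamma}(\mathbb{R})$ is the set of real-valued functions $g$ on $\mathbb{R}$ with $\sup_{x\neq y}\frac{|g(x)-g(y)|}{|x-y|^\gamma}<\infty$; in particular when $\alpha=1$ the space $C^{\frac{1+\alpha}{2}}(\mathbb{R})$ is the space of Lipschitz functions. *)

(* Defs.v *)
From HB Require Import structures.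
From mathcomp Require Import all_boot all_order all_algebra.
From mathcomp Require Import all_classical all_reals all_analysis.

Set Implicit Arguments.
Unset Strict Implicit.
Unset Printing Implicit Defensive.

Import Order.TTheory GRing.Theory Num.Theory.
Import numFieldNormedType.Exports.

Local Open Scope classical_set_scope.
Local Open Scope ring_scope.

Definition holder_seminorm (R : realType) (gamma : R) (g : R -> R) : \bar R :=
  ereal_sup [set (`|g p.1 - g p.2| / (`|p.1 - p.2| `^ gamma))%:E
            | p in [set p : R * R | p.1 != p.2]].

(* Only the seminorm is required to be finite: functions may be unbounded. *)
Definition holder_space (R : realType) (gamma : R) : set (R -> R) :=
  [set g | (holder_seminorm gamma g < +oo)%E].

(* Pointwise derivability is stated separately because derive1 is total. *)
Definition C1_holder_space (R : realType) (alpha : R) : set (R -> R) :=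
  [set f | [/\ forall x : R, derivable f x 1,
               continuous (derive1 f)
             & (holder_seminorm alpha (derive1 f) < +oo)%E]].

(* Main.v *)
Require Import Defs.
From HB Require Import structures.
From mathcomp Require Import all_boot all_order all_algebra.
From mathcomp Require Import all_classical all_reals all_analysis.
From mathcomp Require Import ring lra.

(** Comparing [f] at [x - t] and [x + t] with its first-order expansion at [x],
    non-negativity forces [|f' x| * t <= f x + K * t ^ (1 + alpha)] for every
    [t > 0]. With [b = (1 + alpha) / 2], the increment [h = |y - x|] and the
    scale [t] given by [t ^ b = sqrt (f x) + h ^ b], the expansion of [f] at [x]
    becomes [f y <= f x + C * (sqrt (f x) + h ^ b) * h ^ b] with
    [C = 1 + 2 * K], and the right-hand side is at most
    [(sqrt (f x) + C * h ^ b) ^ 2]. *)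

Set Implicit Arguments.
Unset Strict Implicit.
Unset Printing Implicit Defensive.

Import Order.TTheory GRing.Theory Num.Theory.
Import numFieldNormedType.Exports.

Local Open Scope classical_set_scope.
Local Open Scope ring_scope.

Lemma holder_spaceP (R : realType) (gamma : R) (g : R -> R) :
  holder_space gamma g <->
  exists2 K : R, 0 <= K & forall x y, `|g x - g y| <= K * `|x - y| `^ gamma.
Proof.
split=> [gfin | [K K0 gK]].
(* The maximum with [0] makes the constant non-negative and rules out the value [-oo], so that
   [fine] loses nothing. *)
- exists (fine (Order.max 0%E (holder_seminorm gamma g))).
    by rewrite fine_ge0 // le_max lexx.
  move=> x y; have [->|xy] := eqVneq x y.
    rewrite subrr normr0 mulr_ge0 ?powR_ge0 //.
    by rewrite fine_ge0 // le_max lexx.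
  have d0 : 0 < `|x - y| `^ gamma by rewrite powR_gt0 // normr_gt0 subr_eq0.
  rewrite -ler_pdivrMr // -lee_fin fineK.
    rewrite le_max; apply/orP; right; apply: ereal_sup_ubound.
    by exists (x, y).
  rewrite fin_numE; apply/andP; split.
    by rewrite gt_eqF // lt_max ltNy0.
  by rewrite lt_eqF // gt_max ltry.
- apply: (@le_lt_trans _ _ K%:E); last exact: ltry.
  apply: ge_ereal_sup => _ [[x y] /= xy <-].
  by rewrite lee_fin ler_pdivrMr ?gK // powR_gt0 // normr_gt0 subr_eq0.
Qed.

(** By the mean value theorem the remainder equals [(df c - df x) * (y - x)] for some [c] between
    [x] and [y], and the Hölder bound on [df] applies with [|c - x| <= |y - x|]. *)
Lemma first_order_remainder_le (R : realType) (alpha K : R) (f df : R -> R)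
    (alpha0 : 0 < alpha) (K0 : 0 <= K)
    (fd : forall x : R, is_derive x (1 : R) f (df x))
    (fK : forall x y, `|df x - df y| <= K * `|x - y| `^ alpha) (x y : R) :
  `|f y - f x - df x * (y - x)| <= K * `|y - x| `^ alpha * `|y - x|.
Proof.
have [c cxy ->] : exists2 c, `|c - x| <= `|y - x| &
    f y - f x = df c * (y - x).
  have cont (i : interval R) : {within [set` i], continuous f}.
    by apply: derivable_within_continuous => z _; exact: ex_derive.
  have [xy|/ltW yx] := leP x y.
  - have [c + ->] := MVT_segment xy (fun z _ => fd z) (cont _).
    rewrite in_itv /= => /andP[xc cy]; exists c => //.
    by rewrite !ger0_norm ?subr_ge0 ?lerB.
  - have [c + e] := MVT_segment yx (fun z _ => fd z) (cont _).
    rewrite in_itv /= => /andP[yc cx]; exists c.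
      by rewrite !ler0_norm ?subr_le0 // lerN2 lerB.
    by rewrite -opprB e -mulrN opprB.
rewrite -mulrBl normrM ler_wpM2r //; apply: le_trans (fK _ _) _.
by rewrite ler_wpM2l // ge0_ler_powR ?nnegrE // ltW.
Qed.

Lemma norm_derive_nonneg_le (R : realType) (alpha K : R) (f df : R -> R)
    (alpha0 : 0 < alpha) (K0 : 0 <= K)
    (fd : forall x : R, is_derive x (1 : R) f (df x))
    (fK : forall x y, `|df x - df y| <= K * `|x - y| `^ alpha)
    (f0 : forall x, 0 <= f x) (x t : R) : 0 < t ->
  `|df x| * t <= f x + K * t `^ alpha * t.
Proof.
move=> t0.
move: (first_order_remainder_le alpha0 K0 fd fK x (x + t)) (f0 (x + t)).
move: (first_order_remainder_le alpha0 K0 fd fK x (x - t)) (f0 (x - t)).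
move: (f (x + t)) (f (x - t)) => u v.
rewrite !(addrC x) !addrK mulrN normrN (gtr0_norm t0) !ler_norml.
move=> /andP[_ hm] v0 /andP[_ hp] u0.
rewrite -[X in _ * X <= _](gtr0_norm t0) -normrM ler_norml.
by apply/andP; split; lra.
Qed.

Lemma sqrt_nonneg_le (R : realType) (alpha K : R) (f df : R -> R)
    (alpha0 : 0 < alpha) (alpha1 : alpha <= 1) (K0 : 0 <= K)
    (fd : forall x : R, is_derive x (1 : R) f (df x))
    (fK : forall x y, `|df x - df y| <= K * `|x - y| `^ alpha)
    (f0 : forall x, 0 <= f x) (x y : R) : x != y ->
  Num.sqrt (f y) <=
    Num.sqrt (f x) + (1 + 2 * K) * `|y - x| `^ ((1 + alpha) / 2).
Proof.
move=> xy; have b0 : 0 < (1 + alpha) / 2 by lra.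
set b := (1 + alpha) / 2 in b0 *; set h := `|y - x|.
have h0 : 0 < h by rewrite normr_gt0 subr_eq0 eq_sym.
set s := Num.sqrt (f x); set w := h `^ b.
have s0 : 0 <= s by exact: sqrtr_ge0.
have w0 : 0 < w by exact: powR_gt0.
have fxE : f x = s ^+ 2 by rewrite sqr_sqrtr.
pose t := (s + w) `^ b^-1.
have t0 : 0 < t by rewrite powR_gt0 // ltr_wpDl.
have tb : t `^ b = s + w.
  by rewrite -powRrM mulVf ?gt_eqF // powRr1 // addr_ge0 // ltW.
have ht : h <= t.
  have -> : h = w `^ b^-1.
    by rewrite -powRrM mulfV ?gt_eqF // powRr1 // ltW.
  by rewrite ge0_ler_powR ?invr_ge0 ?nnegrE ?addr_ge0 ?lerDr // ltW.
have tD p q : t `^ (p + q) = t `^ p * t `^ q.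
  by rewrite powRD // (gt_eqF t0) implybT.
(* Since [1 + alpha = 2 * b], one has [t ^ b = t ^ alpha * t ^ (1 - b)]. As
   [1 - b = (1 - alpha) / 2] is non-negative, [h <= t] gives [h ^ (1 - b) <= t ^ (1 - b)]. *)
have ta_h : t `^ alpha * h <= (s + w) * w.
  have -> : h = h `^ (1 - b) * w.
    by rewrite -powRD ?(gt_eqF h0) ?implybT // subrK powRr1 // ltW.
  rewrite mulrA ler_wpM2r ?(ltW w0) //.
  have -> : s + w = t `^ alpha * t `^ (1 - b).
    by rewrite -tb -tD; congr (_ `^ _); rewrite /b; field.
  rewrite ler_wpM2l ?powR_ge0 // ge0_ler_powR ?nnegrE ?(ltW h0) ?(ltW t0) //.
  by rewrite /b; lra.
have ta_t : t `^ alpha * t = (s + w) ^+ 2.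
  rewrite -[X in _ * X](powRr1 (ltW t0)) -tD -tb expr2 -tD.
  by congr (_ `^ _); rewrite /b; field.
(* Here [f x = s ^ 2 <= (s + w) ^ 2 = t ^ alpha * t], so [f x] is absorbed into the error term
   before dividing by [t]. *)
have f't : `|df x| <= (1 + K) * t `^ alpha.
  rewrite -(ler_pM2r t0); apply: le_trans (norm_derive_nonneg_le alpha0 K0 fd fK f0 x t0) _.
  rewrite -!mulrA ta_t mulrDl mul1r lerD2r fxE.
  by rewrite lerXn2r ?nnegrE ?lerDl ?addr_ge0 // ltW.
have hta : h `^ alpha <= t `^ alpha.
  by rewrite ge0_ler_powR ?nnegrE ?(ltW h0) ?(ltW t0) // ltW.
(* In the constant, [1 + K] comes from the bound on [df x], and the other [K] from the remainder
   once [h ^ alpha] is enlarged to [t ^ alpha]. *)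
have fy : f y <= f x + (1 + 2 * K) * ((s + w) * w).
  have d1 : df x * (y - x) <= (1 + K) * t `^ alpha * h.
    by rewrite (le_trans (ler_norm _)) // normrM ler_wpM2r.
  have d2 : K * h `^ alpha * h <= K * t `^ alpha * h.
    by rewrite ler_wpM2r ?(ltW h0) // ler_wpM2l.
  have := first_order_remainder_le alpha0 K0 fd fK x y; rewrite ler_norml => /andP[_].
  have := ler_wpM2l (_ : 0 <= 1 + 2 * K) ta_h.
  rewrite -/h; move=> /(_ ltac:(lra)); lra.
have Cw : w <= (1 + 2 * K) * w by rewrite ler_peMl ?(ltW w0) //; lra.
rewrite -(@ler_pXn2r _ 2) ?nnegrE ?sqrtr_ge0 ?addr_ge0 //; last first.
  by rewrite (le_trans _ Cw) ?ltW.
rewrite sqr_sqrtr //; apply: le_trans fy _; rewrite fxE.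
(* With [C = 1 + 2 * K >= 1], the right side minus the left side is
   [C * s * w + C * (C - 1) * w ^ 2]. *)
nra.
Qed.

Theorem theorem2p15 (R : realType) (alpha : R) (f : R -> R)
    (halpha0 : 0 < alpha) (halpha1 : alpha <= 1)
    (hf : C1_holder_space alpha f)
    (hf0 : forall x : R, 0 <= f x) :
  holder_space ((1 + alpha) / 2) (fun x : R => Num.sqrt (f x)).
Proof.
case: hf => fd _ /holder_spaceP [K K0 fK].
have C0 : 0 <= 1 + 2 * K by lra.
have fD x : is_derive x (1 : R) f (derive1 f x).
  by rewrite derive1E; exact: derivableP.
apply/holder_spaceP; exists (1 + 2 * K) => // x y.
have [->|xy] := eqVneq x y; first by rewrite subrr normr0 mulr_ge0 ?powR_ge0.
(* The one-sided estimate, used for both orders of the two points, bounds the absolute value. *)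
have := sqrt_nonneg_le halpha0 halpha1 K0 fD fK hf0 xy.
rewrite eq_sym in xy.
have := sqrt_nonneg_le halpha0 halpha1 K0 fD fK hf0 xy.
rewrite (distrC y x) ler_norml; lra.
Qed.
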